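(* Let $\mathcal{T}$ be a finite or countably infinite set, let $\prec$ be a strict total order on $\mathcal{T}$, let $\mathbf{p},\mathbf{q}$ be probability distributions on $\mathcal{T}$, and let $m$ be a positive integer. Let $X_0 \sim \mathbf{q}$, $X_1,\dots,X_m \sim^{\mathrm{iid}} \mathbf{p}$, $U_0,\dots,U_m \sim^{\mathrm{iid}} \mathrm{Uniform}(0,1)$ be mutually independent, and let $R = \sum_{j=1}^m \big(\mathbb{I}[X_j \prec X_0] + \mathbb{I}[X_j = X_0, U_j < U_0]\big)$. For $x \in \mathcal{T}$ let $\tilde{\mathbf{p}}(x) = \sum_{x' \prec x} \mathbf{p}(x')$. Then for $0 \le r \le m$, $$\Pr[R = r] = \sum_{x\in\mathcal{T}} H(x,m,r)\,\mathbf{q}(x),$$ where $H(x,m,r)$ is defined as follows. If $0 < \mathbf{p}(x) < 1$, writing $\rho(x) = \tilde{\mathbf{p}}(x)/(1-\mathbf{p}(x))$, $$H(x,m,r) = \sum_{e=0}^m \left\{ \left[ \sum_{j=0}^{e} \binom{m-e}{r-j} \rho(x)^{r-j} \big(1-\rho(x)\big)^{(m-e)-(r-j)} \frac{1}{e+1} \right] \binom{m}{e} \mathbf{p}(x)^e (1-\mathbf{p}(x))^{m-e} \right\};$$ if $\mathbf{p}(x) = 0$, $H(x,m,r) = \binom{m}{r}\tilde{\mathbf{p}}(x)^r (1-\tilde{\mathbf{p}}(x))^{m-r}$; and if $\mathbf{p}(x) = 1$, $H(x,m,r) = \frac{1}{m+1}$.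
   Context: $\mathbb{I}[\cdot]$ denotes the indicator of an event. Conventions: $\binom{n}{k} = 0$ when $k<0$ or $k>n$, and $0^0 = 1$. *)

(* Defs.v *)
From HB Require Import structures.
From mathcomp Require Import all_boot all_order all_algebra.
From mathcomp Require Import all_classical all_reals all_analysis.
Set Implicit Arguments. Unset Strict Implicit. Unset Printing Implicit Defensive.
Import Order.TTheory GRing.Theory Num.Theory.
Local Open Scope classical_set_scope.
Local Open Scope ring_scope.

Definition strict_total_order (T : eqType) (lt : rel T) : Prop :=
  [/\ (forall x, ~~ lt x x),
      (forall x y z, lt x y -> lt y z -> lt x z) &
      (forall x y, x != y -> lt x y || lt y x)].

Definition prob_dist (R : realType) (T : choiceType) (p : T -> R) : Prop :=
  (forall t, 0 <= p t) /\ (\esum_(t in [set: T]) (p t)%:E = 1)%E.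

Definition ptilde (R : realType) (T : choiceType) (lt : rel T) (p : T -> R) (x : T) : R :=
  fine (\esum_(y in [set y | lt y x]) (p y)%:E)%E.

(* H(x,m,r), expressed through pt = p~(x) and pp = p(x);
   binomial 'C(a,b) is 0 when b > a, and terms with r - j < 0 are 0. *)
Definition Hfun (R : realType) (pt pp : R) (m r : nat) : R :=
  if pp == 0 then 'C(m, r)%:R * pt ^+ r * (1 - pt) ^+ (m - r)
  else if pp == 1 then (m.+1)%:R^-1
  else let rho := pt / (1 - pp) in
    \sum_(e < m.+1)
      ((\sum_(j < e.+1)
          (if (j <= r)%N then
             'C(m - e, r - j)%:R * rho ^+ (r - j) * (1 - rho) ^+ ((m - e) - (r - j))
             * (e.+1)%:R^-1
           else 0))
       * 'C(m, e)%:R * pp ^+ e * (1 - pp) ^+ (m - e)).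

Definition H (R : realType) (T : choiceType) (lt : rel T) (p : T -> R) (x : T) (m r : nat) : R :=
  Hfun (ptilde lt p x) (p x) m r.

(* mutual independence of X_0..X_m, U_0..U_m (T carries the discrete sigma-algebra,
   R the Borel one): product rule for every choice of events *)
Definition mutually_independent d (Omega : measurableType d) (R : realType)
  (P : probability Omega R) (T : Type) (m : nat)
  (X : 'I_m.+1 -> Omega -> T) (U : 'I_m.+1 -> Omega -> R) : Prop :=
  forall (A : 'I_m.+1 -> set T) (B : 'I_m.+1 -> set R),
    (forall i, measurable (B i)) ->
    P (\bigcap_(i in [set: 'I_m.+1]) (X i @^-1` A i `&` U i @^-1` B i)) =
    (\prod_(i < m.+1) (P (X i @^-1` A i) * P (U i @^-1` B i)))%E.

Definition rank_stat (R : realType) (T : eqType) (lt : rel T) (m : nat)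
  (X : 'I_m.+1 -> T) (U : 'I_m.+1 -> R) : nat :=
  \sum_(j < m.+1 | j != ord0)
     (nat_of_bool (lt (X j) (X ord0)) + nat_of_bool ((X j == X ord0) && (U j < U ord0)%R))%N.

(* Main.v *)
(* Condition on [X_0 = x] and [U_0 = u]: each [j] contributes to [R] independently with
   probability [ptilde x + p x * u], so [R] is binomial, and [P(R = r | X_0 = x)] is the
   integral over [u] in [0, 1] of a binomial probability. Expanding that probability by
   the number [e] of ties and integrating each Bernstein polynomial to [1 / (e + 1)]
   gives [H].
   The conditioning on [U_0] is made elementary by monotonicity: on [s <= U_0 < t] the
   number of contributions lies between its values for the constant thresholds [s] and
   [t]. Hence the increments of [t |-> P(X_0 = x, U_0 < t, R >= r)] are squeezed exactly
   like those of a polynomial antiderivative, which determines them. *)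

Require Import Defs.
From HB Require Import structures.
From mathcomp Require Import all_boot all_order all_algebra.
From mathcomp Require Import all_classical all_reals all_analysis.
From mathcomp Require Import measurable_realfun ring lra.
Set Implicit Arguments.
Unset Strict Implicit.
Unset Printing Implicit Defensive.
Import Order.TTheory GRing.Theory Num.Theory.
Local Open Scope classical_set_scope.
Local Open Scope ring_scope.

(** * Binomial probabilities and their generating polynomials *)

Definition bin_pmf (R : pzRingType) (n k : nat) (s : R) : R :=
  'C(n, k)%:R * s ^+ k * (1 - s) ^+ (n - k).

(** The generating polynomial of [n] independent trials is the [n]-th power of that of one trial, so
    identities between binomial laws become identities between powers of linear polynomials. *)
Lemma bin_pmf_coef (R : comNzRingType) n k (s : R) :
  (((1 - s)%:P + s *: 'X) ^+ n)`_k = bin_pmf n k s.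
Proof.
rewrite exprDn coef_sum.
have E (i : 'I_n.+1) : (((1 - s)%:P ^+ (n - i) * (s *: 'X) ^+ i) *+ 'C(n, i))`_k =
    if k == i then bin_pmf n i s else 0.
  rewrite -polyC_exp exprZn coefMn coefCM coefZ coefXn /bin_pmf.
  case: eqP => _; last by rewrite !mulr0 mul0rn.
  by rewrite mulr1 -[LHS]mulr_natl mulrA mulrAC.
rewrite (eq_bigr _ (fun i _ => E i)) -big_mkcond /=.
have [kn|nk] := ltnP k n.+1.
  by rewrite (big_pred1 (Ordinal kn)).
rewrite /bin_pmf bin_small // !mul0r big1 // => i /eqP ki.
by move: (ltn_ord i); rewrite -ki ltnNge nk.
Qed.

(* A success has probability [u] with weight [b] and [rho] with weight [1 - b]:
   condition on the number [e] of trials of the first kind. *)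
Lemma bin_pmf_mixture (R : comNzRingType) m r (rho b u : R) :
  bin_pmf m r ((1 - b) * rho + b * u) =
  \sum_(e < m.+1) (\sum_(j < e.+1)
      if (j <= r)%N then bin_pmf (m - e) (r - j) rho * bin_pmf e j u else 0)
    * 'C(m, e)%:R * b ^+ e * (1 - b) ^+ (m - e).
Proof.
rewrite -bin_pmf_coef.
(* The generating polynomial of one trial is the mixture of those with parameters [rho] and [u]; the
   binomial theorem applied to this sum runs over [e]. *)
have -> : (1 - ((1 - b) * rho + b * u))%:P + ((1 - b) * rho + b * u) *: 'X =
   (1 - b) *: ((1 - rho)%:P + rho *: 'X) + b *: ((1 - u)%:P + u *: 'X).
  rewrite !scalerDr !scalerA -!mul_polyC -!polyCM addrACA -polyCD -mulrDl -polyCD.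
  by congr (_ %:P + _); ring.
rewrite exprDn coef_sum; apply: eq_bigr => e _.
rewrite !exprZn -scalerAl -scalerAr scalerA coefMn coefZ.
(* The coefficient of a product is a convolution over [j <= r], whereas [H] sums over [j <= e]. Both
   are widened to a common range; the terms with [j > e] vanish with the binomial coefficient. *)
have -> : \sum_(j < e.+1) (if (j <= r)%N then
      bin_pmf (m - e) (r - j) rho * bin_pmf e j u else 0) =
   \sum_(j < r.+1) bin_pmf e j u * bin_pmf (m - e) (r - j) rho.
  rewrite -big_mkcond /= (big_ord_widen_cond (e.+1 + r.+1) (fun j => j <= r)%N
    (fun j => bin_pmf (m - e) (r - j) rho * bin_pmf e j u)) ?leq_addr //.
  rewrite [RHS](big_ord_widen (e.+1 + r.+1)
    (fun j => bin_pmf e j u * bin_pmf (m - e) (r - j) rho)) ?leq_addl //.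
  rewrite [LHS]big_mkcond [RHS]big_mkcond; apply: eq_bigr => j _ /=.
  rewrite !ltnS; have [jr|rj] := leqP j r; have [je|ej] := leqP j e => //=.
    by rewrite mulrC.
  by rewrite [bin_pmf e j u]/bin_pmf bin_small // !mul0r.
rewrite [X in polyseq X]mulrC coefM; under eq_bigr do rewrite !bin_pmf_coef.
set c := \sum_(_ < _) _; set x := b ^+ e; set y := (1 - b) ^+ _.
by rewrite -mulr_natr; ring.
Qed.

(** * Integration of polynomial functions over [0, 1] *)

(** The integral is a relation witnessed by a polynomial antiderivative, because the increments of
    that antiderivative are what the squeeze argument compares. *)
Definition integral01 (R : nzRingType) (f : R -> R) (v : R) :=
  exists2 F : {poly R}, (forall u, F^`().[u] = f u) & F.[1] - F.[0] = v.

Section integral01.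
Variable R : comNzRingType.
Implicit Types (f g : R -> R) (v w c : R).

Lemma eq_integral01 f g v : f =1 g -> integral01 f v -> integral01 g v.
Proof. by move=> fg [F Ff Fv]; exists F => // u; rewrite -fg. Qed.

Lemma integral01_cst c : integral01 (fun=> c) c.
Proof.
exists (c *: 'X) => [u|]; last by rewrite !hornerE; ring.
by rewrite derivZ derivX !hornerE.
Qed.

Lemma integral01Z c f v : integral01 f v -> integral01 (fun u => c * f u) (c * v).
Proof.
move=> [F Ff <-]; exists (c *: F) => [u|]; first by rewrite derivZ hornerZ Ff.
by rewrite !hornerZ mulrBr.
Qed.

Lemma integral01_sum (I : Type) (s : seq I) (Q : pred I) (f : I -> R -> R) (v : I -> R) :
  (forall i, Q i -> integral01 (f i) (v i)) ->
  integral01 (fun u => \sum_(i <- s | Q i) f i u) (\sum_(i <- s | Q i) v i).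
Proof.
move=> fv; elim: s => [|i s [F Ff Fv]].
  by rewrite big_nil; apply: eq_integral01 (integral01_cst 0) => u; rewrite big_nil.
rewrite big_cons; case: (boolP (Q i)) => Qi; last first.
  by exists F => // u; rewrite big_cons (negbTE Qi).
have [G Gf <-] := fv i Qi.
exists (G + F) => [u|]; last by rewrite !hornerD -Fv; ring.
by rewrite big_cons Qi derivD hornerD Gf Ff.
Qed.

End integral01.

Definition bernstein (R : nzRingType) (n k : nat) : {poly R} :=
  'C(n, k)%:R *: ('X^k * (1 - 'X) ^+ (n - k)).

Lemma horner_bernstein (R : comNzRingType) n k (u : R) :
  (bernstein R n k).[u] = bin_pmf n k u.
Proof. by rewrite hornerZ hornerM hornerXn horner_exp !hornerE. Qed.

(** The factors [k.+1] and [n - k] from the product rule are absorbed into the binomial coefficient,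
    each leaving a factor [n.+1]. *)
Lemma deriv_bernstein (R : comNzRingType) n k :
  (bernstein R n.+1 k.+1)^`() = n.+1%:R *: (bernstein R n k - bernstein R n k.+1).
Proof.
rewrite /bernstein derivZ derivM derivXn deriv_exp derivB derivX derivC sub0r.
rewrite subSS -subnS /= mulN1r mulNrn mulrN mulrnAl mulrnAr !scalerBr.
rewrite -!scaler_nat !scalerA -!natrM [in LHS]mulnC -mul_bin_diag.
by rewrite [X in - (X%:R *: _)]mulnC -subSS -mul_bin_down.
Qed.

(* The antiderivative is the normalized tail of the Bernstein basis of degree
   [e.+1], whose derivative telescopes. *)
Lemma integral01_bin_pmf (R : numFieldType) e j : (j <= e)%N ->
  integral01 (bin_pmf e j) (e.+1%:R^-1 : R).
Proof.
move=> je; have e0 : e.+1%:R != 0 :> R by rewrite pnatr_eq0.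
exists (e.+1%:R^-1 *: \sum_(j <= i < e.+1) bernstein R e.+1 i.+1).
  move=> u; rewrite derivZ raddf_sum /=.
  under eq_bigr do rewrite deriv_bernstein -opprB scalerN -scalerN.
  rewrite -scaler_sumr scalerA mulVf // scale1r sumrN telescope_sumr; last exact: leqW.
  by rewrite opprB hornerD hornerN !horner_bernstein [bin_pmf e e.+1 u]/bin_pmf bin_small //; ring.
(* At [1] only the top term [i = e] survives, the others containing a positive power of [1 - u]; at
   [0] all terms vanish, since the index [i.+1] is positive. *)
rewrite !hornerZ !horner_sum big_nat_recr //= [X in _ * (X + _) - _]big_nat big1 => [|i].
  rewrite add0r [X in _ - _ * X]big1 => [|i _].
    by rewrite horner_bernstein /bin_pmf binn subnn !expr1n; ring.
  by rewrite horner_bernstein /bin_pmf expr0n /=; ring.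
move=> /andP[_ ie].
by rewrite horner_bernstein /bin_pmf subrr expr0n subn_eq0 leqNgt ltnS ie /= mulr0.
Qed.

(** The cases of [Hfun] are the cases of this integral: the integrand is constant for [b = 0], a
    single Bernstein polynomial for [b = 1] (then [a = 0]), and otherwise, with [a = (1 - b) * rho],
    a mixture whose terms integrate to [1 / (e + 1)]. *)
Lemma integral01_Hfun (R : realType) m r (a b : R) :
  0 <= a -> 0 <= b -> a + b <= 1 -> (r <= m)%N ->
  integral01 (fun u => bin_pmf m r (a + b * u)) (Hfun a b m r).
Proof.
move=> a0 b0 ab rm; rewrite /Hfun; case: eqP => [->|/eqP bn0].
  by apply: eq_integral01 (integral01_cst _) => u; rewrite mul0r addr0.
case: eqP => [b1|/eqP bn1].
  have -> : a = 0 by lra.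
  apply: eq_integral01 (integral01_bin_pmf R rm) => u.
  by rewrite b1 mul1r add0r.
have b1 : 1 - b != 0 by rewrite subr_eq0 eq_sym.
set rho := a / (1 - b).
apply: (@eq_integral01 _ (fun u => bin_pmf m r ((1 - b) * rho + b * u))).
  by move=> u; rewrite [(1 - b) * _]mulrC divfK.
apply: (@eq_integral01 _ (fun u => _) _ _ (fun u => esym (bin_pmf_mixture m r _ b u))).
apply: integral01_sum => e _.
rewrite -!mulrA [X in integral01 _ X]mulrC.
apply: (@eq_integral01 _ (fun u => ('C(m, e)%:R * (b ^+ e * (1 - b) ^+ (m - e))) *
  \sum_(j < e.+1)
  (if (j <= r)%N then bin_pmf (m - e) (r - j) rho * bin_pmf e j u else 0))).
  by move=> u; rewrite [LHS]mulrC !mulrA.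
apply: integral01Z; apply: integral01_sum => j _.
case: ifP => _; last exact: integral01_cst.
by apply: integral01Z; apply: integral01_bin_pmf; rewrite -ltnS.
Qed.

(** * Functions determined by monotone bounds on their increments *)

(* The sandwich forces the increments of [F] and [G] over an interval of the grid
   of mesh [1/N] to differ by at most [1/N] times the increment of [h]. *)
Lemma monotone_sandwich_unique (R : realType) (h F G : R -> R) :
  (forall s t, 0 <= s -> s < t -> t <= 1 ->
     (t - s) * h s <= F t - F s <= (t - s) * h t) ->
  (forall s t, 0 <= s -> s < t -> t <= 1 ->
     (t - s) * h s <= G t - G s <= (t - s) * h t) ->
  F 1 - F 0 = G 1 - G 0.
Proof.
move=> hF hG; pose D t := F t - G t.
have step s t : 0 <= s -> s < t -> t <= 1 -> `|D t - D s| <= (t - s) * (h t - h s).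
  move=> s0 st t1; have := hF s t s0 st t1; have := hG s t s0 st t1.
  by rewrite /D ler_norml !mulrBr => /andP[? ?] /andP[? ?]; apply/andP; split; lra.
have bound N : `|D 1 - D 0| <= N.+1%:R^-1 * (h 1 - h 0).
  have N0 : N.+1%:R != 0 :> R by rewrite pnatr_eq0.
  pose x k : R := k%:R / N.+1%:R.
  have x1 : x N.+1 = 1 by rewrite /x divff.
  have x0 : x 0%N = 0 by rewrite /x mul0r.
  have dx k : x k.+1 - x k = N.+1%:R^-1 by rewrite /x -mulrBl -natr1 addrAC subrr add0r mul1r.
  suff : `|D (x N.+1) - D (x 0%N)| <= N.+1%:R^-1 * (h (x N.+1) - h (x 0%N)).
    by rewrite x1 x0.
  (* Both [D] and [h] telescope along the grid, so the total error is the mesh times [h 1 - h 0]. *)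
  rewrite -(telescope_sumr (fun k => D (x k))) // -(telescope_sumr (fun k => h (x k))) //.
  rewrite mulr_sumr (le_trans (ler_norm_sum _ _ _)) // big_nat [leRHS]big_nat.
  apply: ler_sum => k /andP[_ kN]; rewrite -(dx k); apply: step.
  - by rewrite divr_ge0.
  - by rewrite -subr_gt0 dx invr_gt0 ltr0n.
  - by rewrite ler_pdivrMr ?ltr0n // mul1r ler_nat.
suff : D 1 - D 0 = 0 by rewrite /D; lra.
apply/eqP; rewrite -normr_le0; apply/ler_addgt0Pr => e e0; rewrite add0r.
set c := h 1 - h 0 in bound.
have [N Nc] : exists N : nat, c / e < N.+1%:R.
  exists (Num.truncn (c / e)); exact: truncnS_gt.
apply: (le_trans (bound N)).
by rewrite mulrC ler_pdivrMr ?ltr0n // mulrC -ler_pdivrMr // ltW.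
Qed.

(** By the mean value theorem the increment is [(t - s) * h c] with [c] between [s] and [t], and
    monotonicity bounds [h c]. *)
Lemma integral01_sandwich (R : realType) (h : R -> R) (F : {poly R}) :
  (forall u, F^`().[u] = h u) ->
  (forall s t, 0 <= s -> s <= t -> t <= 1 -> h s <= h t) ->
  forall s t, 0 <= s -> s < t -> t <= 1 ->
    (t - s) * h s <= F.[t] - F.[s] <= (t - s) * h t.
Proof.
move=> Fh hmono s t s0 st t1.
have [|c] := @MVT R (horner F) (fun u => F^`().[u]) s t st (fun x _ => is_derive_poly F x).
  by apply: derivable_within_continuous => x _; exact: derivable_horner.
rewrite in_itv /= => /andP[sc ct] ->; rewrite Fh [h c * _]mulrC.
by rewrite !ler_pM2l ?subr_gt0 //; apply/andP; split; apply: hmono; lra.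
Qed.

(** * Counting successes in a sequence of finite-valued trials *)

(** Expanding the [m]-th power of the sum of [w i *: 'X^(g i)] gives one monomial per outcome
    sequence, with the number of successes as exponent; the hypotheses reduce the same sum to
    [(1 - s) + s X]. *)
Lemma sum_bin_pmf (R : comNzRingType) (I : finType) (m : nat) (s : R) (w : I -> R)
    (g : pred I) (Q : pred nat) :
  \sum_(i | g i) w i = s -> \sum_(i | ~~ g i) w i = 1 - s ->
  \sum_(c : {ffun 'I_m -> I} | Q (\sum_(j < m) g (c j))%N) \prod_(j < m) w (c j) =
  \sum_(k < m.+1 | Q k) bin_pmf m k s.
Proof.
move=> ws ws'.
have E k : bin_pmf m k s = \sum_(c : {ffun 'I_m -> I})
    if (k == \sum_(j < m) g (c j))%N then \prod_(j < m) w (c j) else 0.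
  rewrite -bin_pmf_coef.
  have -> : (1 - s)%:P + s *: 'X = \sum_i w i *: 'X^(g i) :> {poly R}.
    rewrite (bigID g) /= addrC -ws' -ws scaler_suml rmorph_sum /=.
    congr (_ + _); apply: eq_bigr => i; last by move=> ->; rewrite expr1.
    by move=> /negbTE ->; rewrite expr0 alg_polyC.
  rewrite -[X in _ ^+ X]card_ord -prodr_const bigA_distr_bigA coef_sum.
  apply: eq_bigr => c _; rewrite scaler_prod -expr_sum coefZ coefXn.
  by case: eqP => _; rewrite ?mulr1 ?mulr0.
under [RHS]eq_bigr do rewrite E.
rewrite exchange_big [LHS]big_mkcond /=; apply: eq_bigr => c _.
have cm : (\sum_(j < m) g (c j) < m.+1)%N.
  rewrite ltnS -[X in (_ <= X)%N]card_ord -sum1_card.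
  by apply: leq_sum => j _; case: (g _).
rewrite [RHS]big_mkcond (bigD1 (Ordinal cm)) //= eqxx.
rewrite [X in _ + X]big1 ?addr0 //= => k kc.
case: ifP => // _; case: eqP => // kE; case/eqP: kc; exact: val_inj.
Qed.

(** * Decomposing an event along a finite or countable partition *)

Section classes.
Context d (Omega : measurableType d) (R : realType) (P : probability Omega R).

Lemma measurable_fin_class (I : finType) (C : Omega -> I) (Q : pred I) :
  (forall i, measurable (C @^-1` [set i])) -> measurable [set w | Q (C w)].
Proof.
move=> mC; have -> : [set w | Q (C w)] = \bigcup_(i in [set` Q]) C @^-1` [set i].
  by apply/seteqP; split=> [w /= Qw|w [i Qi /= ->]//]; exists (C w).
by apply: fin_bigcup_measurable => // i _.
Qed.

Lemma probability_fin_class (I : finType) (C : Omega -> I) (Q : pred I) (E : set Omega) :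
  measurable E -> (forall i, measurable (C @^-1` [set i])) ->
  P (E `&` [set w | Q (C w)]) = (\sum_(i | Q i) P (E `&` C @^-1` [set i]))%E.
Proof.
move=> mE mC.
have -> : E `&` [set w | Q (C w)] = \bigcup_(i in [set` Q]) (E `&` C @^-1` [set i]).
  by apply/seteqP; split=> [w [Ew /= Qw]|w [i Qi [? /= Ci]]]; [exists (C w)|rewrite /= Ci].
rewrite measure_fin_bigcup //; last 2 first.
- exact: trivIset_preimage1_in.
- by move=> i _; exact: measurableI.
rewrite (fsbigE [seq i <- index_enum I | Q i]) ?filter_uniq ?index_enum_uniq //.
- rewrite big_filter_cond; apply: eq_bigl => i.
  by apply: andb_idr => Qi; rewrite mem_set.
- by move=> i /=; rewrite mem_filter => /andP[].
- by move=> i /= Qi; rewrite mem_filter mem_index_enum andbT => /negP.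
Qed.

(** Countable additivity is applied over the codes [pickle x], and the sum is carried back along
    this injection. Assuming only the slices measurable lets [E] be an event understood slice by
    slice. *)
Lemma probability_countable_class (T : countType) (X : Omega -> T) (E : set Omega) :
  (forall x, measurable (E `&` X @^-1` [set x])) ->
  P E = (\esum_(x in [set: T]) P (E `&` X @^-1` [set x]))%E.
Proof.
move=> mE; pose F n := E `&` X @^-1` [set x | pickle x = n].
have FE x : F (pickle x) = E `&` X @^-1` [set x].
  congr (_ `&` _); apply/seteqP; split=> w /= => [|->//].
  exact: (pcan_inj pickleK).
rewrite [X in P X = _](_ : E = \bigcup_(n in range (@pickle T)) F n); last first.
  apply/seteqP; split=> [w Ew|w [n _ []]//].
  by exists (pickle (X w)) => //; exists (X w).
rewrite measure_bigcup; last 2 first.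
- by move=> _ [x _ <-]; rewrite FE.
- by apply: (@trivIset_preimage1_in _ _ (range pickle) E (pickle \o X)).
rewrite nneseries_esum // set_mem_set.
rewrite esum_image; last by move=> x y _ _; apply: (pcan_inj pickleK).
by apply: eq_esum => x _; rewrite FE.
Qed.

Lemma probability_preimage (T : countType) (X : Omega -> T) (A : set T) :
  (forall B : set T, measurable (X @^-1` B)) ->
  P (X @^-1` A) = (\esum_(x in A) P (X @^-1` [set x]))%E.
Proof.
move=> mX; rewrite (@probability_countable_class _ X) => [|x]; last exact: measurableI.
rewrite [RHS]esum_mkcond; apply: eq_esum => x _; case: ifPn; rewrite ?inE ?notin_setE => Ax.
  by congr (P _); apply/seteqP; split=> [w []//|w /= ->].
by rewrite (_ : _ `&` _ = set0) // -subset0 => w [/= + wx]; rewrite wx.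
Qed.

End classes.

(** * The uniform law on intervals *)

Lemma uniform_prob01E (R : realType) (i : interval R) :
  uniform_prob (@ltr01 R) [set` i] = lebesgue_measure ([set` i] `&` `[0, 1]).
Proof.
rewrite /uniform_prob integral_uniform_pdf.
rewrite (eq_integral (cst 1%E)) => [|x]; last first.
  by rewrite inE => -[_] /=; rewrite in_itv /= /uniform_pdf => ->; rewrite subr0 invr1.
by rewrite integral_cst ?mul1e //; apply: measurableI => //; exact: measurable_itv.
Qed.

Lemma uniform_prob01_lt (R : realType) (u : R) : 0 <= u -> u <= 1 ->
  uniform_prob (@ltr01 R) `]-oo, u[ = u%:E.
Proof.
move=> u0 u1; rewrite uniform_prob01E.
rewrite (_ : _ `&` _ = `[0, u[%classic); last first.
  apply/seteqP; split=> v; rewrite /= !in_itv /=; first by move=> [-> /andP[->]].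
  by move=> /andP[-> vu]; split=> //; lra.
rewrite lebesgue_measure_itv /= lte_fin; case: ltP => uE.
  by rewrite -EFinB subr0.
by congr EFin; lra.
Qed.

Lemma uniform_prob01_itv (R : realType) (s t : R) : 0 <= s -> s < t -> t <= 1 ->
  uniform_prob (@ltr01 R) `[s, t[ = (t - s)%:E.
Proof.
move=> s0 st t1; rewrite uniform_prob01E.
rewrite (_ : _ `&` _ = `[s, t[%classic); last first.
  apply/seteqP; split=> v; rewrite /= !in_itv /=; first by move=> [].
  by move=> /andP[sv vt]; split; apply/andP; split=> //; lra.
by rewrite lebesgue_measure_itv /= lte_fin st EFinB.
Qed.

(** * The rank on [X_0 = x] as a count of hits *)

Section hits.
Context (R : realType) (T : countType) (lt : rel T) (p q : T -> R) (m : nat)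
  (d : measure_display) (Omega : measurableType d) (P : probability Omega R)
  (X : 'I_m.+1 -> Omega -> T) (U : 'I_m.+1 -> Omega -> R) (x : T).

(** The threshold [u] is kept apart from [U_0]: for constant [u], the hits depend only on the
    variables of index at least 1. *)
Definition hit (u : R) (w : Omega) (j : 'I_m) : bool :=
  lt (X (lift ord0 j) w) x || ((X (lift ord0 j) w == x) && (U (lift ord0 j) w < u)).

Definition hits (u : R) (w : Omega) : nat := \sum_(j < m) hit u w j.

Lemma leq_hits u v w : u <= v -> (hits u w <= hits v w)%N.
Proof.
move=> uv; apply: leq_sum => j _; rewrite /hit; case: lt => //=.
by case: eqP => //= _; case: (ltP _ u) => // Uu; rewrite (lt_le_trans Uu uv).
Qed.

Hypothesis lt_order : strict_total_order lt.

(** Irreflexivity makes the two indicators in the rank exclusive, so their sum is the indicator of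
    the disjunction. *)
Lemma rank_stat_hits w : X ord0 w = x ->
  rank_stat lt (fun i => X i w) (fun i => U i w) = hits (U ord0 w) w.
Proof.
move=> X0; rewrite /rank_stat big_mkcond big_ord_recl /= add0n; apply: eq_bigr => j _ /=.
rewrite X0 /hit; have [irr _ _] := lt_order.
by case: eqP => [->|_] /=; rewrite ?(negbTE (irr x)) ?orbF ?addn0.
Qed.

Hypothesis mX : forall i (A : set T), measurable (X i @^-1` A).
Hypothesis mU : forall i, measurable_fun [set: Omega] (U i).

Let mUB i (B : set R) : measurable B -> measurable (U i @^-1` B).
Proof. by move=> mB; rewrite -[X in measurable X]setTI; exact: (mU i measurableT mB). Qed.

(** The vector of hits takes finitely many values, and each of its fibres is a finite intersection
    of hit events or their complements. A random threshold [v] covers both constants and [U_0]. *)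
Lemma measurable_hits (v : Omega -> R) (Q : pred nat) :
  measurable_fun [set: Omega] v -> measurable [set w | Q (hits (v w) w)].
Proof.
move=> mv; pose C w := [ffun j => hit (v w) w j].
have -> : [set w | Q (hits (v w) w)] = [set w | Q (\sum_(j < m) C w j)%N].
  apply/funext => w /=; congr (is_true (Q _)).
  by apply: eq_bigr => j _; rewrite ffunE.
apply: (@measurable_fin_class _ _ _ C (fun c => Q (\sum_(j < m) c j)%N)) => c.
have mhit j : measurable [set w | hit (v w) w j].
  have -> : [set w | hit (v w) w j] = X (lift ord0 j) @^-1` [set y | lt y x] `|`
      (X (lift ord0 j) @^-1` [set x] `&` [set w | U (lift ord0 j) w < v w]).
    apply/seteqP; split=> w /=; rewrite /hit.
      by case/orP => [|/andP[/eqP]]; [left|right].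
    by case=> [->//|[-> ->]]; rewrite eqxx orbT.
  apply: measurableU; first exact: mX.
  apply: measurableI; first exact: mX.
  have := measurable_fun_ltr (mU (lift ord0 j)) mv.
  by move=> /(_ measurableT [set true] I); rewrite setTI preimage_true.
have -> : C @^-1` [set c] =
    \bigcap_(j in [set: 'I_m]) [set w | hit (v w) w j = c j].
  apply/seteqP; split=> w /=; first by move=> <- j _ /=; rewrite ffunE.
  by move=> wc; apply/ffunP => j; rewrite ffunE; exact: wc.
apply: fin_bigcap_measurable => // j _.
case: (c j); first exact: mhit.
rewrite [X in measurable X](_ : _ = ~` [set w | hit (v w) w j]).
  exact: measurableC.
by apply/seteqP; split=> w /= => [->|/negP/negbTE].
Qed.

Hypothesis p_dist : prob_dist p.
Hypothesis indep : mutually_independent P X U.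
Hypothesis PX0 : forall t, P (X ord0 @^-1` [set t]) = (q t)%:E.
Hypothesis PXj : forall j, j != ord0 -> forall t, P (X j @^-1` [set t]) = (p t)%:E.
Hypothesis PU : forall i (B : set R), measurable B ->
  P (U i @^-1` B) = uniform_prob (@ltr01 R) B.

Lemma probability_below j : j != ord0 ->
  P (X j @^-1` [set y | lt y x]) = (ptilde lt p x)%:E.
Proof.
move=> j0; have E := probability_preimage P [set y | lt y x] (mX j).
rewrite [LHS]E; under eq_esum do rewrite PXj //.
(* [fine] loses nothing here: the sum is itself the probability of an event, hence finite. *)
rewrite /ptilde fineK //.
under eq_esum do rewrite -(PXj j0).
by rewrite -E fin_num_measure.
Qed.

Lemma probability_below_or_eq j : j != ord0 ->
  P (X j @^-1` ([set y | lt y x] `|` [set x])) = (ptilde lt p x + p x)%:E.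
Proof.
move=> j0; rewrite EFinD -(probability_below j0) -(PXj j0) preimage_setU.
apply: measureU; [exact: mX|exact: mX|].
have [irr _ _] := lt_order.
by rewrite -subset0 => w [/= + wx]; rewrite wx (negbTE (irr x)).
Qed.

Hypothesis m_gt0 : (0 < m)%N.

Lemma ptilde_bounds : [/\ 0 <= ptilde lt p x, 0 <= p x & ptilde lt p x + p x <= 1].
Proof.
have [p0 _] := p_dist.
split=> //; first by rewrite fine_ge0 // esum_ge0 // => y _; rewrite lee_fin.
have j0 : (lift ord0 (Ordinal m_gt0)) != ord0 by [].
by rewrite -lee_fin -(probability_below_or_eq j0) probability_le1.
Qed.

(** * The joint law of the hits for a constant threshold *)

(* The event that [j] is counted is not a rectangle in [(X_j, U_j)]; splitting it
   and its complement according to whether [X_j = x] gives four rectangles, indexed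
   by (counted, tied). *)
Definition cellX (c : bool * bool) : set T :=
  if c.2 then [set x]
  else if c.1 then [set y | lt y x] else ~` ([set y | lt y x] `|` [set x]).

Definition cellU (u : R) (c : bool * bool) : set R :=
  if c.2 then if c.1 then `]-oo, u[%classic else ~` `]-oo, u[%classic else setT.

Definition cell_weight (u : R) (c : bool * bool) : R :=
  if c.2 then p x * (if c.1 then u else 1 - u)
  else if c.1 then ptilde lt p x else 1 - (ptilde lt p x + p x).

Lemma measurable_cellU u c : measurable (cellU u c).
Proof. by rewrite /cellU; case: c => [[] []] //=; apply: measurableC. Qed.

Lemma probability_cell u j c : 0 <= u -> u <= 1 -> j != ord0 ->
  (P (X j @^-1` cellX c) * P (U j @^-1` cellU u c))%E = (cell_weight u c)%:E.
Proof.
move=> u0 u1 j0; rewrite /cellX /cellU /cell_weight.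
have Plt : P (U j @^-1` `]-oo, u[%classic) = u%:E.
  by rewrite PU // uniform_prob01_lt.
have Pge : P (U j @^-1` (~` `]-oo, u[%classic)) = (1 - u)%:E.
  rewrite -preimage_setC probability_setC ?Plt //.
  exact: mUB (measurable_itv _).
have PT : P (U j @^-1` setT) = 1%E by rewrite preimage_setT probability_setT.
have Pnbe : P (X j @^-1` (~` ([set y | lt y x] `|` [set x]))) =
    (1 - (ptilde lt p x + p x))%:E.
  by rewrite -preimage_setC probability_setC // probability_below_or_eq // [RHS]EFinB.
case: c => [[] []] /=.
- by rewrite EFinM -Plt -(PXj j0).
- by rewrite -(probability_below j0) -[RHS]mule1 -PT.
- by rewrite EFinM -Pge -(PXj j0).
- by rewrite -Pnbe -[RHS]mule1 -PT.
Qed.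

(** By irreflexivity a value below [x] is never tied, so the four rectangles are exactly the fibres
    of the pair of flags. *)
Lemma cellP u w j c : cellX c (X (lift ord0 j) w) /\ cellU u c (U (lift ord0 j) w) <->
  (hit u w j, X (lift ord0 j) w == x) = c.
Proof.
have [irr _ _] := lt_order.
rewrite /hit; move: (X _ w) (U _ w) => y v.
have [->|/eqP yx] := eqVneq y x.
  rewrite (negbTE (irr x)) /= /cellX /cellU.
  case: c => [[] []] /=; rewrite ?in_itv /=.
  - by split=> [[_ ->]|[->]].
  - by split=> [[]|[]] //; rewrite (negbTE (irr x)).
  - by split=> [[_ /negP/negbTE ->]|[->]].
  - by split=> [[/not_orP[]]|[]].
rewrite orbF /cellX /cellU.
case: c => [[] []] /=; first by split=> [[]|].
- by split=> [[->]|[->]].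
- by split=> [[]|].
- by split=> [[/not_orP[/negP/negbTE ->]]|[/negbT/negP ltyx]] //; split=> //; exact/not_orP.
Qed.

(** With [[set x]] and [B] placed at index 0, each configuration of cells is one product event, to
    which independence applies; summing over configurations is then a count of successes. *)
Lemma probability_hits (u pB : R) (B : set R) (Q : pred nat) :
  0 <= u -> u <= 1 -> measurable B -> P (U ord0 @^-1` B) = pB%:E ->
  P (X ord0 @^-1` [set x] `&` U ord0 @^-1` B `&` [set w | Q (hits u w)]) =
  (q x * pB * \sum_(k < m.+1 | Q k) bin_pmf m k (ptilde lt p x + p x * u))%:E.
Proof.
move=> u0 u1 mB PB.
pose C w := [ffun j => (hit u w j, X (lift ord0 j) w == x)].
pose ev (A : 'I_m.+1 -> set T) (B : 'I_m.+1 -> set R) :=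
  \bigcap_(i in [set: 'I_m.+1]) (X i @^-1` A i `&` U i @^-1` B i).
pose AX (c : {ffun 'I_m -> bool * bool}) i :=
  if unlift ord0 i is Some j then cellX (c j) else [set x].
pose BU (c : {ffun 'I_m -> bool * bool}) i :=
  if unlift ord0 i is Some j then cellU u (c j) else B.
have evE c : X ord0 @^-1` [set x] `&` U ord0 @^-1` B `&` C @^-1` [set c] = ev (AX c) (BU c).
  apply/seteqP; split=> w.
    move=> [[/= X0 U0] Cc] i _; rewrite /AX /BU; case: unliftP => [j ->|->] //=.
    by apply/cellP; rewrite -Cc ffunE.
  move=> wev; have := wev ord0 I; rewrite /AX /BU unlift_none => ?.
  split=> //=; apply/ffunP => j; rewrite ffunE; apply/cellP.
  by have := wev (lift ord0 j) I; rewrite /AX /BU liftK.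
have mBU c i : measurable (BU c i).
  by rewrite /BU; case: unlift => // j; exact: measurable_cellU.
have -> : [set w | Q (hits u w)] = [set w | Q (\sum_(j < m) (C w j).1)%N].
  apply/funext => w /=; congr (is_true (Q _)).
  by apply: eq_bigr => j _; rewrite ffunE.
rewrite (@probability_fin_class _ _ _ _ _ C (fun c => Q (\sum_(j < m) (c j).1)%N)); last 2 first.
- by apply: measurableI; [exact: mX | exact: mUB].
- move=> c; have -> : C @^-1` [set c] = \bigcap_(j in [set: 'I_m])
      (X (lift ord0 j) @^-1` cellX (c j) `&` U (lift ord0 j) @^-1` cellU u (c j)).
    apply/seteqP; split=> w /=.
      by move=> Cc j _; apply/cellP; rewrite -Cc ffunE.
    by move=> wev; apply/ffunP => j; rewrite ffunE; apply/cellP; exact: (wev j).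
  apply: fin_bigcap_measurable => // j _.
  by apply: measurableI; [exact: mX | exact: (mUB _ (measurable_cellU _ _))].
under eq_bigr => c _.
  rewrite evE /ev indep // big_ord_recl /AX /BU unlift_none PX0 PB -EFinM.
  under eq_bigr => j _ do rewrite !liftK probability_cell //.
  rewrite prodEFin -EFinM.
  over.
rewrite sumEFin -mulr_sumr; congr (_ * _)%:E.
(* The two counted cells have total weight [ptilde lt p x + p x * u], the other two the
   complementary weight. *)
apply: (@sum_bin_pmf _ _ _ _ (cell_weight u) (fun c => c.1) Q).
  rewrite big_mkcond -(pair_bigA _ (fun h e => if h then cell_weight u (h, e) else 0)).
  by rewrite !big_bool /cell_weight /=; ring.
rewrite big_mkcond -(pair_bigA _ (fun h e => if ~~ h then cell_weight u (h, e) else 0)).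
by rewrite !big_bool /cell_weight /=; ring.
Qed.

(** * Averaging over [U_0] by monotone squeezing *)

(** Tails are used because [r <= hits] is monotone in the threshold, which equality with [r] is
    not. *)
Lemma probability_rank_ge (r : nat) :
  P (X ord0 @^-1` [set x] `&` [set w | (r <= hits (U ord0 w) w)%N]) =
  (q x * \sum_(k < m.+1 | (r <= k)%N) Hfun (ptilde lt p x) (p x) m k)%:E.
Proof.
have [a0 b0 ab1] := ptilde_bounds.
pose h u := q x * \sum_(k < m.+1 | (r <= k)%N) bin_pmf m k (ptilde lt p x + p x * u).
pose ev (B : set R) := X ord0 @^-1` [set x] `&` U ord0 @^-1` B.
pose ge (v : Omega -> R) := [set w | (r <= hits (v w) w)%N].
have mge v : measurable_fun [set: Omega] v -> measurable (ge v).
  by move=> mv; exact: (measurable_hits (leq r) mv).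
have mev B : measurable B -> measurable (ev B).
  by move=> mB; apply: measurableI; [exact: mX | exact: (mUB _ mB)].
have mevge B v : measurable B -> measurable_fun [set: Omega] v -> measurable (ev B `&` ge v).
  by move=> mB mv; apply: measurableI; [exact: mev | exact: mge].
have Pev u B pB : 0 <= u -> u <= 1 -> measurable B -> P (U ord0 @^-1` B) = pB%:E ->
    P (ev B `&` ge (cst u)) = (pB * h u)%:E.
  move=> u0 u1 mB PB; rewrite /ev /ge (probability_hits (leq r) u0 u1 mB PB) /h.
  by congr EFin; ring.
have le_ge s t : s <= t -> ge (cst s) `<=` ge (cst t).
  by move=> st w /= rs; exact: leq_trans rs (leq_hits _ st).
(* Monotonicity of [h] is read off from probabilities: with [B] the whole line, [h s] and [h t] are
   the probabilities of nested events. *)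
have h_mono s t : 0 <= s -> s <= t -> t <= 1 -> h s <= h t.
  move=> s0 st t1; rewrite -lee_fin -[h s]mul1r -[h t]mul1r.
  have PT : P (U ord0 @^-1` setT) = 1%:E by rewrite preimage_setT probability_setT.
  rewrite -(Pev s setT 1) //; last by lra.
  rewrite -(Pev t setT 1) //; last by lra.
  apply: le_measure; rewrite ?inE; try exact: mevge.
  exact: setIS (le_ge _ _ st).
pose evlt t := ev `]-oo, t[%classic `&` ge (U ord0).
have mevlt t : measurable (evlt t).
  by apply: mevge => //; exact: measurable_itv.
have evltD s t : 0 <= s -> s < t -> t <= 1 ->
    (t - s) * h s <= fine (P (evlt t)) - fine (P (evlt s)) <= (t - s) * h t.
  move=> s0 st t1.
  have mst : measurable `[s, t[%classic by exact: measurable_itv.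
  have PI : P (U ord0 @^-1` `[s, t[%classic) = (t - s)%:E.
    by rewrite PU // uniform_prob01_itv.
  have mD : measurable (ev `[s, t[%classic `&` ge (U ord0)) by exact: mevge.
  have -> : fine (P (evlt t)) - fine (P (evlt s)) =
      fine (P (ev `[s, t[%classic `&` ge (U ord0))).
    have -> : evlt t = evlt s `|` (ev `[s, t[%classic `&` ge (U ord0)).
      apply/seteqP; split=> w.
        move=> [[X0 /=]]; rewrite in_itv /= => Ut Rr.
        have [Us|Us] := ltP (U ord0 w) s.
          by left; split=> //; split=> //=; rewrite in_itv.
        by right; split=> //; split=> //=; rewrite in_itv /= Us.
      move=> [] [[X0 /=]]; rewrite in_itv /= => Us Rr; split=> //; split=> //=.
        by rewrite in_itv /= (lt_trans Us).
      by rewrite in_itv /=; case/andP: Us.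
    have PU2 : P (evlt s `|` (ev `[s, t[%classic `&` ge (U ord0))) =
        (P (evlt s) + P (ev `[s, t[%classic `&` ge (U ord0)))%E.
      apply: measureU => //; rewrite -subset0 => w [[[_ /=]]].
      rewrite in_itv /= => Us _ [[_ /=]].
      by rewrite in_itv /= leNgt Us.
    by rewrite PU2 fineD ?fin_num_measure // addrC addKr.
  (* On [s <= U_0 < t] the count at [U_0] lies between the counts at [s] and [t], whose tail
     probabilities [Pev] evaluates with [pB = t - s]. *)
  apply/andP; split; rewrite -lee_fin fineK ?fin_num_measure //.
    rewrite -(Pev s `[s, t[%classic) //; last by lra.
    apply: le_measure; rewrite ?inE //; first exact: mevge.
    move=> w [[X0 /= Uw] rs]; split=> //; apply: leq_trans rs (leq_hits _ _).
    by move: Uw; rewrite in_itv /= => /andP[].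
  rewrite -(Pev t `[s, t[%classic) //; last by lra.
  apply: le_measure; rewrite ?inE //; first exact: mevge.
  move=> w [[X0 /= Uw] rs]; split=> //; apply: leq_trans rs (leq_hits _ _).
  by move: Uw; rewrite in_itv /= => /andP[_ /ltW].
have hint : integral01 h (q x * \sum_(k < m.+1 | (r <= k)%N) Hfun (ptilde lt p x) (p x) m k).
  apply: integral01Z; apply: integral01_sum => k _.
  by apply: integral01_Hfun => //; rewrite -ltnS.
have [G Gh <-] := hint.
rewrite -(monotone_sandwich_unique evltD (integral01_sandwich Gh h_mono)).
(* Almost surely [0 <= U_0 < 1]: the increment from [0] to [1] starts at zero and captures the whole
   event. *)
have E0 : P (evlt 0) = 0%E.
  apply/eqP; rewrite -measure_le0.
  have PU0 : P (U ord0 @^-1` `]-oo, 0[%classic) = 0%E.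
    by rewrite PU // uniform_prob01_lt.
  rewrite -PU0; apply: le_measure; rewrite ?inE //; first exact: (mUB _ (measurable_itv _)).
  by move=> w [[]].
rewrite E0 subr0 fineK ?fin_num_measure //.
pose A := U ord0 @^-1` `]-oo, 1[%classic.
have mA : measurable A by exact: (mUB _ (measurable_itv _)).
have PAc : P (~` A) = 0%E.
  by rewrite probability_setC // PU // uniform_prob01_lt // subee.
pose E := X ord0 @^-1` [set x] `&` ge (U ord0).
have mE : measurable E by apply: measurableI; [exact: mX | exact: mge].
have -> : P E = (P (E `\` A) + P (E `&` A))%E by exact: measureDI.
have -> : P (E `\` A) = 0%E.
  apply/eqP; rewrite -measure_le0 -PAc; apply: le_measure; rewrite ?inE //.
    exact: measurableD.
  exact: measurableC.
by rewrite add0e /E /A /evlt /ev -!setIA [ge _ `&` _]setIC.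
Qed.

(** The tails at [r] and [r.+1] are nested, and the difference of their sums leaves the single term
    [k = r]. *)
Lemma probability_rank_eq (r : nat) : (r <= m)%N ->
  P ([set w | rank_stat lt (fun i => X i w) (fun i => U i w) = r] `&` X ord0 @^-1` [set x]) =
  (H lt p x m r * q x)%:E.
Proof.
move=> rm.
pose ge k := X ord0 @^-1` [set x] `&` [set w | (k <= hits (U ord0 w) w)%N].
have mge k : measurable (ge k).
  by apply: measurableI; [exact: mX | exact: (measurable_hits (leq k) (mU ord0))].
have -> : [set w | rank_stat lt (fun i => X i w) (fun i => U i w) = r] `&`
    X ord0 @^-1` [set x] = ge r `\` ge r.+1.
  apply/seteqP; split=> w.
    move=> [/= + X0]; rewrite rank_stat_hits // => <-.
    by split; [split=> //= | move=> [_ /=]; rewrite ltnn].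
  move=> [[/= X0 rk] nrk]; split=> //=; rewrite rank_stat_hits //.
  apply/eqP; rewrite eqn_leq rk andbT leqNgt; apply/negP => lt_r.
  exact: nrk.
have -> : P (ge r `\` ge r.+1) = (P (ge r) - P (ge r `&` ge r.+1))%E.
  by apply: measureD => //; rewrite ltey_eq fin_num_measure.
rewrite setIidr; last by move=> w [X0 rk]; split=> //; exact: ltnW.
rewrite /ge !probability_rank_ge -EFinB -mulrBr mulrC; congr (_ * _)%:E.
rewrite (bigD1 (Ordinal (rm : (r < m.+1)%N))) //= /H.
rewrite (eq_bigl (fun k : 'I_m.+1 => (r < k)%N)) ?addrK // => k.
by rewrite ltn_neqAle andbC eq_sym -val_eqE.
Qed.

End hits.

(** * Summation over the values of [X_0] *)

Theorem theorem3p8 (R : realType) (T : countType) (lt : rel T)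
  (p q : T -> R) (m : nat)
  (d : measure_display) (Omega : measurableType d) (P : probability Omega R)
  (X : 'I_m.+1 -> Omega -> T) (U : 'I_m.+1 -> Omega -> R) :
  strict_total_order lt ->
  prob_dist p -> prob_dist q ->
  (0 < m)%N ->
  (forall i (A : set T), measurable (X i @^-1` A)) ->
  (forall i, measurable_fun [set: Omega] (U i)) ->
  mutually_independent P X U ->
  (forall t, P (X ord0 @^-1` [set t]) = (q t)%:E) ->
  (forall j, j != ord0 -> forall t, P (X j @^-1` [set t]) = (p t)%:E) ->
  (forall i (B : set R), measurable B ->
     P (U i @^-1` B) = uniform_prob (@ltr01 R) B) ->
  forall r : nat, (r <= m)%N ->
    P [set w | rank_stat lt (fun i => X i w) (fun i => U i w) = r] =
    (\esum_(x in [set: T]) (H lt p x m r * q x)%:E)%E.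
Proof.
move=> lt_order p_dist _ m_gt0 mX mU indep PX0 PXj PU r rm.
rewrite (@probability_countable_class _ _ _ _ _ (X ord0)) => [|x].
  apply: eq_esum => x _.
  exact: (@probability_rank_eq _ _ _ p).
(* The rank agrees with [hits] at threshold [U_0] only where [X_0 = x], which is enough for the
   measurability of each slice. *)
rewrite (_ : _ `&` _ = X ord0 @^-1` [set x] `&`
    [set w | pred1 r (hits lt X U x (U ord0 w) w)]).
  by apply: measurableI; [exact: mX | exact: measurable_hits].
apply/seteqP; split=> w /= [rw X0].
  by rewrite -(rank_stat_hits U lt_order X0) rw eqxx.
by move: X0 => /eqP; rewrite (rank_stat_hits U lt_order rw).
Qed.
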